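(* Let $\lambda$ be an infinite cardinal and $K$ a set of infinite cardinals, and suppose that every uniform ultrafilter over $\lambda$ is $\mu$-decomposable for some $\mu\in K$. If $X$ is a topological space, $\mathcal F$ is a family of subsets of $X$, and one (and hence all) of the equivalent conditions $A_1(\lambda)$–$A_4(\lambda)$ listed in the context holds for $X$ and $\mathcal F$, then there is $\mu\in K$ such that the conditions $A_1(\mu)$–$A_4(\mu)$ hold for $X$ and $\mathcal F$. The same applies to the equivalent conditions $B_1$–$B_6$ listed in the context: if $X$ is a topological space and one (and hence all) of these conditions holds for $X$ and the cardinal $\lambda$, then there is $\mu\in K$ such that these conditions hold for $X$ when $\lambda$ is everywhere replaced by $\mu$. (Conditions $B_5$, $B_6$ are considered only when the cardinal in question is regular.)
   Context: No separation axioms are assumed. An ultrafilter over an infinite cardinal $\nu$ is uniform if all its members have cardinality $\nu$. If $D$ is an ultrafilter over a set $Z$ and $f:Z\to\mu$, then $f(D)$ is the ultrafilter over $\mu$ defined by $Y\in f(D)$ iff $f^{-1}(Y)\in D$. $D$ is $\mu$-decomposable if there is $f:Z\to\mu$ such that $f(D)$ is uniform over $\mu$. Let $Y$ be a space, $\mathcal G$ a family of subsets of $Y$, $\nu$ an infinite cardinal, and $(Y_\alpha)_{\alpha\in\nu}$ a sequence of subsets of $Y$ (repetitions allowed). A point $y\in Y$ is a $\nu$-complete accumulation point of the sequence if $|\{\alpha\in\nu\mid Y_\alpha\cap U\neq\emptyset\}|=\nu$ for every neighborhood $U$ of $y$. For $D$ an ultrafilter over $\nu$, $y$ is a $D$-limit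 point of the sequence if $\{\alpha\in\nu\mid Y_\alpha\cap U\ne\emptyset\}\in D$ for every neighborhood $U$ of $y$. $Y$ is $\mathcal G$-$D$-compact if every sequence $(G_\alpha)_{\alpha\in\nu}$ of members of $\mathcal G$ has some $D$-limit point in $Y$; $Y$ is $D$-pseudocompact if this holds for $\mathcal G$ the family of all nonempty open subsets of $Y$. $Y$ satisfies $\mathcal G$-$\mathrm{CAP}^*_\nu$ if every sequence $(G_\alpha)_{\alpha\in\nu}$ of members of $\mathcal G$ has a $\nu$-complete accumulation point in $Y$. $Y$ is $\mathcal G$-$[\nu,\nu]$-compact if for every family $(C_\alpha)_{\alpha\in\nu}$ of closed sets of $Y$ such that for every $Z\subseteq\nu$ with $|Z|<\nu$ there is $G\in\mathcal G$ with $\bigcap_{\alpha\in Z}C_\alpha\supseteq G$, one has $\bigcap_{\alpha\in\nu}C_\alpha\neq\emptyset$. All powers $X^\delta$ ($\delta$ a cardinal) carry the Tychonoff topology. Conditions for $X$ and $\mathcal F$, with $\mathcal F^\delta$ the family of all products of $\delta$ members of $\mathcal F$ (for each infinite cardinal $\nu$ these are equivalent): $A_1(\nu)$: there is an ultrafilter $D$ uniform over $\nu$ such that $X$ is $\mathcal F$-$D$-compact. $A_2(\nu)$: there is an ultrafilter $D$ uniform over $\nu$ such that, for every cardinal $\delta$, $X^\delta$ is $\mathcal F^\delta$-$D$-compact. $A_3(\nu)$: $X^\delta$ satisfies $\mathcal F^\delta$-$\mathrm{CAP}^*_\nu$ for every cardinal $\delta$. $A_4(\nu)$: $X^\delta$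 satisfies $\mathcal F^\delta$-$\mathrm{CAP}^*_\nu$ for $\delta=\min\{2^{2^\nu},|\mathcal F|^\nu\}$. Conditions for $X$ and an infinite cardinal $\nu$ (equivalent to each other), where $\mathcal O^\delta$ denotes either (for all $\delta$) the family of all products of $\delta$ nonempty open sets of $X$, or (for all $\delta$) the family of all nonempty open sets of $X^\delta$ in the box topology: $B_1$: there is an ultrafilter $D$ uniform over $\nu$ such that $X$ is $D$-pseudocompact. $B_2$: there is an ultrafilter $D$ uniform over $\nu$ such that, for every cardinal $\delta$, $X^\delta$ is $\mathcal O^\delta$-$D$-compact. $B_3$: for every cardinal $\delta$, $X^\delta$ satisfies $\mathcal O^\delta$-$\mathrm{CAP}^*_\nu$. $B_4$: $X^\delta$ satisfies $\mathcal O^\delta$-$\mathrm{CAP}^*_\nu$ for $\delta=\min\{2^{2^\nu},\kappa^\nu\}$, where $\kappa$ is the weight of $X$ (least cardinality of a base consisting of nonempty sets). $B_5$ (for $\nu$ regular): for every cardinal $\delta$, $X^\delta$ is $\mathcal O^\delta$-$[\nu,\nu]$-compact. $B_6$ (for $\nu$ regular): for every cardinal $\delta$ and every decreasing family $(C_\alpha)_{\alpha\in\nu}$ of closed sets of $X^\delta$ (i.e. $C_\alpha\supseteq C_\beta$ for $\alpha\le\beta<\nu$) such that each $C_\alpha$ contains some member of $\mathcal O^\delta$, $\bigcap_{\alpha\in\nu}C_\alpha\neq\emptyset$. *)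

(* Defs.v *)
From HB Require Import structures.
From mathcomp Require Import all_boot.
From mathcomp Require Import all_classical wochoice.
From mathcomp Require Import topology.

Set Implicit Arguments.
Unset Strict Implicit.
Unset Printing Implicit Defensive.

Local Open Scope classical_set_scope.
Local Open Scope card_scope.

Definition card_lt T U (A : set T) (B : set U) : bool :=
  (A #<= B) && (A #!= B).

(* Cardinals are initial ordinals: well-ordered types, all of whose proper
   initial segments are strictly smaller than the whole. *)
Record cardinal := Cardinal {
  cpoint :> Type;
  cle : rel cpoint;
  cle_wo : well_order cle;
  cle_initial : forall a : cpoint,
    card_lt [set b | cle b a /\ b <> a] [set: cpoint] }.

Definition infinite_cardinal (nu : cardinal) := infinite_set [set: nu].

Definition cofinal (nu : cardinal) (Z : set nu) :=
  forall a, exists2 b, Z b & cle a b.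

Definition regular_cardinal (nu : cardinal) :=
  infinite_cardinal nu /\ forall Z : set nu, cofinal Z -> Z #= [set: nu].

Lemma sval_inj T (P : T -> Prop) : injective (@sval T P).
Proof. by move=> [x px] [y py] /= xy; exact: eq_exist. Qed.

Lemma card_of_ex (T : Type) : exists k : cardinal, [set: k] #= [set: T].
Proof.
elim/Peq : T => T.
have [R Rwo] := well_ordering_principle T.
have Rwc : wo_chain R predT by move=> A _; exact: Rwo.
have Rxx x : R x x by exact: (wo_chain_reflexive Rwc).
have Ranti x y : R x y -> R y x -> x = y.
  by move=> xy yx; apply: (wo_chain_antisymmetric Rwc) => //; rewrite xy yx.
have [noa|] := pselect (forall a : T,
    card_lt [set b | R b a /\ b <> a] [set: T]).
  by exists (Cardinal Rwo noa).
move=> /existsNP[a0 ha0].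
pose P : {pred T} := fun a => [set: T] #<= [set b | R b a /\ b <> a].
have nP : nonempty P.
  exists a0; apply: contrapT => nPa0; apply: ha0.
  rewrite /card_lt card_eq_le subset_card_le//=; exact/negP.
have [a [[Pa mina] _]] := Rwo P nP.
pose k := {b : T | R b a /\ b <> a}.
pose S : rel k := fun x y => R (sval x) (sval y).
have Swo : well_order S.
  move=> A [x Ax].
  pose B : {pred T} := fun b => `[< exists2 y : k, y \in A & sval y = b >].
  have [|z [[/asboolP[y Ay yz] minz] _]] := Rwo B.
    by exists (sval x); apply/asboolP; exists x.
  exists y; split.
    split=> // w Aw; rewrite /S yz; apply: minz.
    by apply/asboolP; exists w.
  move=> w [Aw minw]; apply: sval_inj; apply: Ranti; last exact: minw.
  by rewrite yz; apply: minz; apply/asboolP; exists w.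
have kE : [set: k] #= [set b | R b a /\ b <> a].
  have /(@inj_card_eq _ _ setT) : {in [set: k] &, injective (@sval T _)}.
    by move=> x y _ _ /=; exact: sval_inj.
  rewrite card_eq_sym => /card_eq_trans; apply.
  suff -> : sval @` [set: k] = [set b | R b a /\ b <> a] by [].
  apply/seteqP; split=> [_ [x _ <-]|b hb]; first exact: (svalP x).
  by exists (exist _ b hb).
have kT : [set: k] #= [set: T].
  by apply: (card_eq_trans kE); rewrite card_eq_le subset_card_le.
have Sinit (b : k) : card_lt [set c | S c b /\ c <> b] [set: k].
  rewrite /card_lt card_leT/=; apply/negP; rewrite card_eq_le => /andP[_ bk].
  have : P (sval b).
    have Tk : [set: T] #<= [set: k].
      by move: kT; rewrite card_eq_le => /andP[].
    apply: (card_le_trans (card_le_trans Tk bk)).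
    have : [set c | S c b /\ c <> b] #<= sval @` [set c | S c b /\ c <> b].
      have : sval @` [set c | S c b /\ c <> b] #=
          [set c | S c b /\ c <> b].
        by apply: inj_card_eq => x y _ _; exact: sval_inj.
      by rewrite card_eq_le => /andP[].
    move=> /card_le_trans; apply; apply: subset_card_le.
    by move=> _ [c [Scb cb] <-]; split=> // bc; exact/cb/sval_inj.
  move=> /mina ab; have [ba nba] := svalP b.
  by apply: nba; exact: Ranti.
by exists (Cardinal Swo Sinit).
Qed.

Definition card_of (T : Type) : cardinal := projT1 (cid (card_of_ex T)).
Definition card_set T (A : set T) : cardinal := card_of {x : T | A x}.

Definition cmin (k l : cardinal) : cardinal :=
  if [set: k] #<= [set: l] then k else l.
Definition cexp (k l : cardinal) : cardinal := card_of (l -> k).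
Definition ctwo : cardinal := card_of bool.

Lemma card_min_ex (I : Type) (A : I -> Type) (i0 : I) :
  exists i, forall j, [set: A i] #<= [set: A j].
Proof.
pose P (M : set (forall i, A i)) :=
  forall i f g, M f -> M g -> f i = g i -> f = g.
have [F FP Ftot|M [PM maxM]] := @Zorn_bigcup _ P.
  move=> i f g [X FX Xf] [Y FY Yg].
  have [XY|YX] := Ftot _ _ FX FY.
    by apply: (FP _ FY) => //; exact: XY.
  by apply: (FP _ FX) => //; exact: YX.
have [i Mi] : exists i, forall a, exists2 f, M f & f i = a.
  apply: contrapT => /forallNP noi.
  have aex i : exists a, forall f, M f -> f i <> a.
    have /existsNP[a na] := noi i; exists a => f Mf fa.
    by apply: na; exists f.
  pose a i := projT1 (cid (aex i)).
  have aM i f : M f -> f i <> a i by exact: (projT2 (cid (aex i))).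
  apply: (maxM (M `|` [set a])).
    split; first by move=> f Mf; left.
    by move=> /(_ a (or_intror erefl)) Ma; exact: (aM i0 a Ma erefl).
  move=> i f g [Mf|->] [Mg|->] fg //; first exact: (PM i).
    by have := aM i _ Mf fg.
  by have := aM i _ Mg (esym fg).
exists i => j.
have /choice[s sP] : forall a, exists f, M f /\ f i = a.
  by move=> a; have [f] := Mi a; exists f.
have sinj : {in [set: A i] &, injective (fun a => s a j)}.
  move=> a b _ _ sab; have [Ma <-] := sP a; have [Mb <-] := sP b.
  by rewrite (PM _ _ _ Ma Mb sab).
have := inj_card_eq sinj; rewrite card_eq_le => /andP[_ /card_le_trans]; apply.
exact: card_leT.
Qed.

Definition nonempty_basis (X : topologicalType) (B : set (set X)) :=
  basis B /\ forall U, B U -> U !=set0.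

Lemma weight_ex (X : topologicalType) : exists B : set (set X),
  nonempty_basis B /\ forall B' : set (set X), nonempty_basis B' -> B #<= B'.
Proof.
pose I := {B : set (set X) | nonempty_basis B}.
have B0 : nonempty_basis [set U : set X | open U /\ U !=set0].
  split; last by move=> U [].
  split=> [U []//|x A]; rewrite nbhsE => -[U [oU Ux] UA].
  by exists U => //; split=> //; split=> //; exists x.
have [[B nB] minB] := card_min_ex (fun i : I => {U | sval i U})
  (exist _ _ B0).
have cardB (C : set (set X)) : [set: {U | C U}] #= C.
  have : sval @` [set: {U | C U}] #= [set: {U | C U}].
    by apply: inj_card_eq => x y _ _; exact: sval_inj.
  rewrite card_eq_sym => /card_eq_trans; apply.
  suff -> : sval @` [set: {U | C U}] = C by [].
  apply/seteqP; split=> [_ [x _ <-]|b hb]; first exact: (svalP x).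
  by exists (exist _ b hb).
exists B; split=> // B' nB'; have := minB (exist _ B' nB') => /=.
by rewrite (card_le_eql (cardB B)) (card_le_eqr (cardB B')).
Qed.

Definition weight (X : topologicalType) : cardinal :=
  card_set (projT1 (cid (weight_ex X))).

Definition uniform_ultrafilter (nu : cardinal) (D : set_system nu) :=
  UltraFilter D /\ forall A, D A -> A #= [set: nu].

Definition decomposable (Z : Type) (D : set_system Z) (mu : cardinal) :=
  exists f : Z -> mu, uniform_ultrafilter (fmap f D).

Section SequencesOfSets.
Variables (Y : topologicalType) (nu : cardinal).
Implicit Types (S : nu -> set Y) (G : set (set Y)) (D : set_system nu).

Definition complete_accumulation_point S (y : Y) :=
  forall U, nbhs y U -> [set alpha | S alpha `&` U !=set0] #= [set: nu].

Definition limit_point_along D S (y : Y) :=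
  forall U, nbhs y U -> D [set alpha | S alpha `&` U !=set0].

Definition D_compact G D := forall S, (forall alpha, G (S alpha)) ->
  exists y, limit_point_along D S y.

Definition D_pseudocompact D :=
  D_compact [set U | open U /\ U !=set0] D.

Definition CAP_star G := forall S, (forall alpha, G (S alpha)) ->
  exists y, complete_accumulation_point S y.

Definition nu_nu_compact G := forall C : nu -> set Y,
  (forall alpha, closed (C alpha)) ->
  (forall Z : set nu, card_lt Z [set: nu] ->
    exists2 A, G A & A `<=` \bigcap_(alpha in Z) C alpha) ->
  \bigcap_alpha C alpha !=set0.

Definition decreasing_compact G := forall C : nu -> set Y,
  (forall alpha, closed (C alpha)) ->
  (forall alpha beta, cle alpha beta -> C beta `<=` C alpha) ->
  (forall alpha, exists2 A, G A & A `<=` C alpha) ->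
  \bigcap_alpha C alpha !=set0.

End SequencesOfSets.

Definition power (X : topologicalType) (delta : cardinal) : topologicalType :=
  prod_topology (fun _ : delta => X).

Definition box (X : topologicalType) (delta : cardinal)
    (S : delta -> set X) : set (power X delta) :=
  [set x | forall i, S i (x i)].

Definition family_power (X : topologicalType) (F : set (set X))
    (delta : cardinal) : set (set (power X delta)) :=
  [set P | exists2 S, forall i, F (S i) & P = box S].
Arguments family_power {X} F delta _.

Definition box_open (X : topologicalType) (delta : cardinal)
    (W : set (power X delta)) :=
  forall x, W x -> exists S : delta -> set X,
    [/\ forall i, open (S i), box S x & box S `<=` W].

(* In both readings only the choice of the family varies: the power itself
   always carries the Tychonoff topology. *)
Inductive open_reading := OpenProducts | BoxOpenSets.

Definition open_power (r : open_reading) (X : topologicalType)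
    (delta : cardinal) : set (set (power X delta)) :=
  match r with
  | OpenProducts => family_power [set U | open U /\ U !=set0] delta
  | BoxOpenSets => [set W | box_open W /\ W !=set0]
  end.
Arguments open_power r X delta _ : clear implicits.

Section Conditions.
Variables (X : topologicalType) (nu : cardinal).

Section Family.
Variable F : set (set X).

Definition condA1 :=
  exists2 D, uniform_ultrafilter D & D_compact (nu := nu) F D.

Definition condA2 := exists2 D, uniform_ultrafilter D &
  forall delta, D_compact (nu := nu) (family_power F delta) D.

Definition condA3 := forall delta, CAP_star nu (family_power F delta).

Definition condA4 := CAP_star nu (family_power F
  (cmin (cexp ctwo (cexp ctwo nu)) (cexp (card_set F) nu))).

End Family.

Definition condB1 :=
  exists2 D, uniform_ultrafilter D & D_pseudocompact X (nu := nu) D.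

Variable r : open_reading.

Definition condB2 := exists2 D, uniform_ultrafilter D &
  forall delta, D_compact (nu := nu) (open_power r X delta) D.

Definition condB3 := forall delta, CAP_star nu (open_power r X delta).

Definition condB4 := CAP_star nu (open_power r X
  (cmin (cexp ctwo (cexp ctwo nu)) (cexp (weight X) nu))).

Definition condB5 :=
  forall delta, nu_nu_compact nu (open_power r X delta).

Definition condB6 :=
  forall delta, decreasing_compact nu (open_power r X delta).

End Conditions.

(* Main.v *)
(**
  Decomposability is used through one observation: if a sequence of sets is
  pulled back along [f : lambda -> mu], its [D]-limit points are [f(D)]-limit
  points of the original sequence. So [D]-compactness of [X] for a uniform [D]
  over [lambda] gives [f(D)]-compactness, and the rest is the equivalence of the
  conditions. A [D]-limit point in a power is found coordinatewise. Conversely,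
  the sets of indices whose member meets a given neighbourhood of a
  [nu]-complete accumulation point extend to a uniform ultrafilter, and taking
  as coordinates of the power either all sequences, or one bad sequence for each
  ultrafilter, turns CAP of that power into compactness along one ultrafilter.
*)

Require Import Defs.
From mathcomp Require Import all_boot.
From mathcomp Require Import all_classical.
From mathcomp Require Import topology.

Set Implicit Arguments.
Unset Strict Implicit.
Unset Printing Implicit Defensive.

Local Open Scope classical_set_scope.
Local Open Scope card_scope.

(** * Comparison of cardinalities and unions of infinite sets *)

Lemma card_le_injex T U (A : set T) (B : set U) (u : U) : A #<= B ->
  exists2 f : T -> U, set_fun A B f & set_inj A f.
Proof.
elim/Ppointed: U => U in B u *; first by case: (no u).
by move=> /pcard_leP/injfunPex.
Qed.

Lemma injex_card_le T U (A : set T) (B : set U) (f : T -> U) :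
  set_fun A B f -> set_inj A f -> A #<= B.
Proof.
move=> fAB finj.
have /injfunPex[g] : exists2 f : T -> U, set_fun A B f & set_inj A f by exists f.
exact: inj_card_le g.
Qed.

(** Comparability is the two-element case of [card_min_ex]. *)
Lemma card_le_or T U (A : set T) (B : set U) : A #<= B \/ B #<= A.
Proof.
have [[] minb] := card_min_ex (fun b : bool => if b then set_type A else set_type B)
  true.
  by left; have := minb false; rewrite (card_le_eql (card_setT A))
    (card_le_eqr (card_setT B)).
by right; have := minb true; rewrite (card_le_eql (card_setT B))
  (card_le_eqr (card_setT A)).
Qed.

(* Up to a finite remainder, which one more countable set absorbs, an infinite
   set is a disjoint union of countably infinite sets (Zorn), and each of these
   splits into its even and its odd part. *)
Lemma infinite_set_double T (B : set T) : infinite_set B ->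
  exists2 g : bool -> T -> T, forall b x, B x -> B (g b x) &
    forall b c x y, B x -> B y -> g b x = g c y -> b = c /\ x = y.
Proof.
move=> Binf.
pose P (M : set (nat -> T)) := (forall s, M s -> forall i, B (s i)) /\
  forall s t i j, M s -> M t -> s i = t j -> s = t /\ i = j.
have [F FP Ftot|M [[MB Minj] maxM]] := @Zorn_bigcup _ P.
  split=> [s [X FX Xs] i|s t i j [X FX Xs] [Y FY Yt]].
    by have [+ _] := FP _ FX; apply.
  by have [XY|YX] := Ftot _ _ FX FY;
    [have [_] := FP _ FY|have [_] := FP _ FX]; apply=> //; [exact: XY|exact: YX].
pose R := B `\` [set x | exists2 s, M s & exists i, x = s i].
have Rfin : finite_set R.
  apply: contrapT => /infiniteP Rinf.
  have [x0 _] := infinite_setN0 Binf.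
  have [s sR sinj] := card_le_injex x0 Rinf.
  have {}sR i : R (s i) by exact: sR.
  have {}sinj i j : s i = s j -> i = j by apply: sinj; rewrite inE.
  apply: (maxM (M `|` [set s])).
    split; first by move=> t Mt; left.
    move=> /(_ s (or_intror erefl)) Ms.
    by have [_] := sR 0; apply; exists s => //; exists 0.
  split=> [t [Mt|->] i|t u i j [Mt|->] [Mu|->]].
  - exact: MB.
  - by have [] := sR i.
  - exact: Minj.
  - by move=> tus; have [_ []] := sR j; exists t => //; exists i.
  - by move=> sut; have [_ []] := sR i; exists u => //; exists j.
  - by move=> /sinj ->.
have [s0 Ms0] : M !=set0.
  apply: contrapT => M0; apply: Binf; apply: sub_finite_set Rfin => x Bx.
  by split=> // -[s Ms _]; apply: M0; exists s.
have /countable_injP[f finj] := finite_set_countable Rfin.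
(* Each point of [B] gets a sequence of [M] and a slot number: points already on a sequence take the
   even slots, points of the finite remainder the odd slots of [s0]. *)
have /choice[c cP] : forall x, exists p : (nat -> T) * nat, B x -> M p.1 /\
    ((exists2 k, x = p.1 k & p.2 = k.*2) \/
     R x /\ p = (s0, (f x).*2.+1)).
  move=> x; have [Rx|nRx] := pselect (R x).
    by exists (s0, (f x).*2.+1) => _; split=> //; right.
  have [Bx|] := pselect (B x); last by exists (s0, 0).
  have [s Ms [k xk]] : exists2 s, M s & exists i, x = s i.
    by apply: contrapT => nx; apply: nRx.
  by exists (s, k.*2) => _; split=> //; left; exists k.
have cinj x y : B x -> B y -> c x = c y -> x = y.
  move=> Bx By cxy; have [_] := cP x Bx; have [_] := cP y By.
  rewrite -cxy => -[[k yk ky]|[Ry cx]] [[l xl lx]|[Rx cx']].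
  - have kl : k = l by apply: double_inj; rewrite -ky -lx.
    by rewrite yk kl.
  - by move: ky; rewrite cx' => /(congr1 odd); rewrite /= !odd_double.
  - by move: lx; rewrite cx => /(congr1 odd); rewrite /= !odd_double.
  - move: cx'; rewrite cx => -[/double_inj]/esym/finj; apply; rewrite inE//.
exists (fun b x => (c x).1 (b + (c x).2.*2)).
  by move=> b x Bx; have [Mc _] := cP x Bx; exact: MB.
move=> b d x y Bx By.
have [Mx _] := cP x Bx; have [My _] := cP y By.
move=> /(Minj _ _ _ _ Mx My)[c1 c2].
have bd : b = d.
  by move/(congr1 odd): c2; rewrite !oddD !odd_double !addbF !oddb.
split=> //; apply: cinj => //.
move: c2; rewrite bd => /addnI/double_inj c2.
by rewrite (surjective_pairing (c x)) c1 c2 -surjective_pairing.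
Qed.

(** The larger of the two sets is infinite and contains two disjoint copies of itself; it goes into
    one copy, and the rest of the smaller set into the other. *)
Lemma infinite_card_setU T (A B : set T) : infinite_set (A `|` B) ->
  A `|` B #<= A \/ A `|` B #<= B.
Proof.
wlog AB : A B / A #<= B => [hwlog|ABinf].
  have [|AB] := card_le_or A B; first exact: hwlog.
  by rewrite setUC => /(hwlog _ _ AB)[]; [right|left].
have Binf : infinite_set B.
  by move=> Bfin; apply: ABinf; rewrite finite_setU; split=> //;
    exact: card_le_finite AB Bfin.
right; have [x0 _] := infinite_setN0 Binf.
have [f fAB finj] := card_le_injex x0 AB.
have [g gB ginj] := infinite_set_double Binf.
pose h x := if pselect (B x) then g false x else g true (f x).
apply: (@injex_card_le _ _ _ _ h) => [x ABx|x y].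
  rewrite /h; case: pselect => Bx; apply: gB => //.
  by case: ABx => // /fAB.
rewrite !inE /h => ABx ABy.
case: pselect => Bx; case: pselect => By.
- by move=> /ginj[].
- case: ABy => // Ay.
  by move=> /(ginj _ _ _ _ Bx (fAB _ Ay))[].
- case: ABx => // Ax.
  by move=> /(ginj _ _ _ _ (fAB _ Ax) By)[].
- case: ABx => // Ax; case: ABy => // Ay.
  move=> /(ginj _ _ _ _ (fAB _ Ax) (fAB _ Ay))[_].
  by apply: finj; rewrite inE.
Qed.

(** * Sets of full cardinality and extension to uniform ultrafilters *)

Lemma card_eq_setTE T (A : set T) : (A #= [set: T]) = ([set: T] #<= A).
Proof. by rewrite card_eq_le card_leT. Qed.

Lemma infinite_card_setUT (nu : cardinal) (A B C : set nu) :
  infinite_cardinal nu -> C `<=` A `|` B -> C #= [set: nu] ->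
  A #= [set: nu] \/ B #= [set: nu].
Proof.
move=> nuinf CAB; rewrite !card_eq_setTE => leC.
have leU := card_le_trans leC (subset_card_le CAB).
have Uinf : infinite_set (A `|` B).
  by move=> /(card_le_finite leU).
have [leA|leB] := infinite_card_setU Uinf; [left|right].
  exact: card_le_trans leA.
exact: card_le_trans leB.
Qed.

(** Sets of smaller cardinality form an ideal, so the sets containing a member of [F] up to a small
    set form a proper filter [G]. It contains the complement of every small set, hence any
    ultrafilter above it is uniform. *)
Lemma uniform_ultrafilter_ext (nu : cardinal) (F : set_system nu) :
  infinite_cardinal nu -> Filter F -> (forall A, F A -> A #= [set: nu]) ->
  exists2 D, uniform_ultrafilter D & F `<=` D.
Proof.
move=> nuinf FF Flarge.
pose G : set_system nu :=
  [set A | exists2 P, F P & ~ (P `\` A #= [set: nu])].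
have N0 : ~ (@set0 nu #= [set: nu]).
  by rewrite card_eq_sym card_eq0 => /eqP nu0; apply: nuinf; rewrite nu0.
have sub (A B : set nu) : A `<=` B -> ~ (B #= [set: nu]) -> ~ (A #= [set: nu]).
  move=> AB; rewrite !card_eq_setTE => nB leA; apply: nB.
  exact: card_le_trans leA (subset_card_le AB).
have PG : ProperFilter G.
  split; first by move=> [P /Flarge]; rewrite setD0.
  split=> [|A B [P FP nA] [Q FQ nB]|A B AB [P FP nA]].
  - by exists setT; [exact: filterT|rewrite setDT].
  - exists (P `&` Q); first exact: filterI.
    move=> /(infinite_card_setUT nuinf (A := P `\` A) (B := Q `\` B))[] //.
    by move=> x [[Px Qx] /not_andP[nAx|nBx]]; [left|right].
  - by exists P => //; apply: sub nA; exact: setDS.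
have [D [DU GD]] := ultraFilterLemma PG.
exists D; last first.
  by move=> A FA; apply: GD; exists A; rewrite // setDv.
split=> // A DA; apply: contrapT => nA.
have : D (~` A).
  by apply: GD; exists setT; [exact: filterT|rewrite setDE setCK setTI].
move=> /(filterI DA); rewrite setICr; exact: filter_not_empty.
Qed.

(** * Complete accumulation points and limit points along ultrafilters *)

Section LimitPoints.
Variables (Y : topologicalType) (nu : cardinal).
Implicit Types (S : nu -> set Y) (D : set_system nu).

Lemma uniform_limit_point_complete D S y : uniform_ultrafilter D ->
  limit_point_along D S y -> complete_accumulation_point S y.
Proof. by move=> [_ Dlarge] Sy U /Sy/Dlarge. Qed.

(** A set meeting an intersection of two neighbourhoods meets both, so the index sets form a filter
    base, whose members have full cardinality by assumption on [y]. *)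
Lemma complete_accumulation_point_limit S y : infinite_cardinal nu ->
  complete_accumulation_point S y ->
  exists2 D, uniform_ultrafilter D & limit_point_along D S y.
Proof.
move=> nuinf Sy.
pose F := filter_from (nbhs y) (fun U => [set a | S a `&` U !=set0]).
have FF : Filter F.
  apply: filter_from_filter => [|U V nU nV]; first by exists setT; exact: filterT.
  exists (U `&` V); first exact: filterI.
  by move=> a [x [Sx [Ux Vx]]]; split; exists x.
have [|D uD FD] := uniform_ultrafilter_ext nuinf FF.
  move=> A [U /Sy SU UA]; move: SU; rewrite !card_eq_setTE => /card_le_trans.
  by apply; exact: subset_card_le.
by exists D => // U nU; apply: FD; exists U.
Qed.

Lemma limit_point_along_sub D S T y : Filter D -> (forall a, S a `<=` T a) ->
  limit_point_along D S y -> limit_point_along D T y.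
Proof.
move=> FD ST Sy U /Sy; apply: filterS => a [x [Sx Ux]].
by exists x; split=> //; exact: ST.
Qed.

Lemma complete_accumulation_point_sub S T y : (forall a, S a `<=` T a) ->
  complete_accumulation_point S y -> complete_accumulation_point T y.
Proof.
move=> ST Sy U /Sy; rewrite !card_eq_setTE => /card_le_trans; apply.
by apply: subset_card_le => a [x [Sx Ux]]; exists x; split=> //; exact: ST.
Qed.

(** A limit point of a sequence of smaller sets is one of the original sequence. This allows passing
    to a base, or from one reading of open families to the other. *)
Lemma D_compact_refine (F G : set (set Y)) D : Filter D ->
  (forall A, F A -> exists2 B, G B & B `<=` A) ->
  D_compact G D -> D_compact F D.
Proof.
move=> FD FG Gcpt S FS.
have /choice[T TP] : forall a, exists B, G B /\ B `<=` S a.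
  by move=> a; have [B] := FG _ (FS a); exists B.
have [|y Ty] := Gcpt T; first by move=> a; have [] := TP a.
by exists y; apply: limit_point_along_sub Ty => a; have [] := TP a.
Qed.

Lemma CAP_star_refine (F G : set (set Y)) :
  (forall A, F A -> exists2 B, G B & B `<=` A) ->
  CAP_star nu G -> CAP_star nu F.
Proof.
move=> FG Gcpt S FS.
have /choice[T TP] : forall a, exists B, G B /\ B `<=` S a.
  by move=> a; have [B] := FG _ (FS a); exists B.
have [|y Ty] := Gcpt T; first by move=> a; have [] := TP a.
by exists y; apply: complete_accumulation_point_sub Ty => a; have [] := TP a.
Qed.

Lemma D_compact_CAP_star (F : set (set Y)) D : uniform_ultrafilter D ->
  D_compact F D -> CAP_star nu F.
Proof.
move=> uD Fcpt S /Fcpt[y Sy]; exists y.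
exact: uniform_limit_point_complete Sy.
Qed.

End LimitPoints.

Lemma D_compact_fmap (Y : topologicalType) (F : set (set Y))
    (lambda mu : cardinal) (f : lambda -> mu) (D : set_system lambda) :
  D_compact F D -> D_compact F (fmap f D).
Proof.
by move=> Fcpt S FS; have [y Sy] := Fcpt (S \o f) (fun a => FS (f a)); exists y.
Qed.

(** * Neighbourhoods and limit points in Tychonoff powers *)

Section Powers.
Variables (X : topologicalType) (delta : cardinal).

Lemma nbhs_power_proj (y : power X delta) i (U : set X) :
  nbhs (y i) U -> nbhs y [set x : power X delta | U (x i)].
Proof.
move=> yU; have /cvg_sup/(_ i) : nbhs y --> y by exact: cvg_id.
apply; exact: (@initial_continuous _ _ (fun x : power X delta => x i) y U yU).
Qed.

(** The product topology is a supremum of initial topologies, so it is enough that the sets [V] with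
    this property form a filter converging to [y] for each coordinate topology. *)
Lemma nbhs_power_box (y : power X delta) (V : set (power X delta)) :
  nbhs y V -> exists T : delta -> set X, [/\ forall i, nbhs (y i) (T i),
    finite_set [set i | T i <> setT] & box T `<=` V].
Proof.
pose F : set_system (power X delta) :=
  [set V | exists T : delta -> set X, [/\ forall i, nbhs (y i) (T i),
    finite_set [set i | T i <> setT] & box T `<=` V]].
have FF : Filter F.
  split=> [|A B [T [nT finT TA]] [T' [nT' finT' TB]]|A B AB [T [nT finT TA]]].
  - exists (fun=> setT); split=> // [i|]; first exact: filterT.
    by apply: (sub_finite_set _ (@finite_set0 delta)) => i /=.
  - exists (fun i => T i `&` T' i); split=> [i||x TTx]; first exact: filterI.
      apply: (@sub_finite_set _ _ ([set i | T i <> setT] `|` [set i | T' i <> setT])).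
        move=> i /= TT; apply: contrapT => /not_orP[/contrapT Ti /contrapT T'i].
        by apply: TT; rewrite Ti T'i setIT.
      by rewrite finite_setU.
    by split; [apply: TA|apply: TB] => i; have [] := TTx i.
  - by exists T; split=> //; exact: subset_trans AB.
suff : F --> y by apply.
apply/cvg_sup => i A; rewrite (@nbhsE (initial_topology (fun x : power X delta => x i))).
move=> [_ [[U oU <-] Uy] UA].
exists (fun j => if pselect (j = i) then U else setT); split.
- move=> j; case: pselect => /= [->|_]; last exact: filterT.
  exact: open_nbhs_nbhs.
- apply: (sub_finite_set _ (finite_set1 i)) => j /=.
  by case: pselect.
- by move=> x /(_ i); case: pselect => //= _; exact: UA.
Qed.

(** A basic neighbourhood restricts finitely many coordinates, and [D] is closed under finite
    intersections; on the other coordinates nonemptiness of [S i a] supplies a point. *)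
Lemma family_power_limit (nu : cardinal) (D : set_system nu)
    (S : delta -> nu -> set X) (y : power X delta) : Filter D ->
  (forall i a, S i a !=set0) -> (forall i, limit_point_along D (S i) (y i)) ->
  limit_point_along D (fun a => box (S^~ a) : set (power X delta)) y.
Proof.
move=> FD S0 Sy V /nbhs_power_box[T [nT finT TV]].
have : D (\bigcap_(i in [set i | T i <> setT]) [set a | S i a `&` T i !=set0]).
  (* The cast to [{classic delta}] provides the choice structure needed to write the support as a
     finite set [E]. *)
  have /finite_fsetP[E ->] : finite_set
    ([set i | T i <> setT] : set {classic delta}) by [].
  by apply: (@filter_bigI _ {classic delta} E _ D FD) => i _; exact: Sy.
apply: filterS => a STa.
have /choice[x xP] : forall i, exists x, S i a x /\ T i x.
  move=> i; have [Ti|/(STa i)[x]] := pselect (T i = setT); last by exists x.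
  by have [x Sx] := S0 i a; exists x; rewrite Ti.
by exists x; split; [move=> i|apply: TV => i]; have [] := xP i.
Qed.

Lemma box_limit_proj (nu : cardinal) (D : set_system nu)
    (S : delta -> nu -> set X) (y : power X delta) i : Filter D ->
  limit_point_along D (fun a => box (S^~ a) : set (power X delta)) y ->
  limit_point_along D (S i) (y i).
Proof.
move=> FD Sy U /nbhs_power_proj/Sy; apply: filterS => a [x [Sx Ux]].
by exists (x i).
Qed.

End Powers.

(** * The well-order of a cardinal and its initial segments *)

Section CardinalOrder.
Variable nu : cardinal.
Implicit Types a b c : nu.

(** The order laws below come from least elements of sets of two or three points; uniqueness of the
    minimum yields antisymmetry. *)
Lemma cle_minimum (A : set nu) : A !=set0 ->
  exists2 m, A m /\ (forall a, A a -> cle m a) &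
    forall n, A n -> (forall a, A a -> cle n a) -> m = n.
Proof.
move=> [x Ax].
have [|m [[Am mA] Um]] := @cle_wo nu (mem A); first by exists x; exact: mem_set.
exists m; first by split=> [|a Aa]; [exact: set_mem|apply: mA; exact: mem_set].
by move=> n An nA; apply: Um; split=> [|a /set_mem]; [exact: mem_set|exact: nA].
Qed.

Lemma cle_total a b : cle a b \/ cle b a.
Proof.
have [|m [[->|->] mA] _] := @cle_minimum [set a; b]; first by exists a; left.
  by left; apply: mA; right.
by right; apply: mA; left.
Qed.

Lemma cle_refl a : cle a a.
Proof. by have [] := cle_total a a. Qed.

Lemma cle_anti a b : cle a b -> cle b a -> a = b.
Proof.
move=> ab ba; have [|m _ Um] := @cle_minimum [set a; b]; first by exists a; left.
rewrite -(Um a) ?(Um b) //; first by right.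
- by move=> c [->|->] //; exact: cle_refl.
- by left.
- by move=> c [->|->] //; exact: cle_refl.
Qed.

Lemma cle_trans a b c : cle a b -> cle b c -> cle a c.
Proof.
move=> ab bc.
have [|m [mE mA] _] := @cle_minimum [set x | [\/ x = a, x = b | x = c]].
  by exists a; constructor 1.
have ma : cle m a by apply: mA; constructor 1.
have mb : cle m b by apply: mA; constructor 2.
have mc : cle m c by apply: mA; constructor 3.
case: mE => m_eq; subst m => //; first by rewrite (cle_anti ab ma).
by rewrite -(cle_anti bc mb).
Qed.

(** [cle_initial] concerns strict segments; adding the endpoint to a smaller set cannot reach an
    infinite cardinality. *)
Lemma card_lt_initial a : infinite_cardinal nu ->
  card_lt [set b | cle b a] [set: nu].
Proof.
move=> nuinf; rewrite /card_lt card_leT /=; apply/negP => large.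
have [||] := infinite_card_setUT nuinf (A := [set b | cle b a /\ b <> a])
  (B := [set a]) _ large.
- move=> b ba; have [->|] := pselect (b = a); first by right.
  by left.
- by apply/negP; have /andP[] := cle_initial a.
- rewrite card_eq_setTE => /card_le_finite/(_ (finite_set1 a)).
  exact: nuinf.
Qed.

(** Otherwise [A] would lie in the strict initial segment of [a], which is too small. *)
Lemma card_eq_unbounded (A : set nu) a : A #= [set: nu] ->
  exists2 b, A b & cle a b.
Proof.
rewrite card_eq_setTE => leA; apply: contrapT => nb.
have /andP[_ /negP] := cle_initial a; apply.
rewrite card_eq_setTE; apply: card_le_trans leA (subset_card_le _) => b Ab.
split; last by move=> ba; apply: nb; exists b => //; rewrite ba; exact: cle_refl.
by have [ab|//] := cle_total a b; case: nb; exists b.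
Qed.

End CardinalOrder.

(** * Decreasing families of closed sets and regular cardinals *)

Section DecreasingFamilies.
Variables (Y : topologicalType) (nu : cardinal) (G : set (set Y)).

Lemma CAP_star_decreasing : CAP_star nu G -> decreasing_compact nu G.
Proof.
move=> cap C Ccl Cdec CG.
have /choice[S SP] : forall a, exists A, G A /\ A `<=` C a.
  by move=> a; have [A] := CG a; exists A.
have [|y Sy] := cap S; first by move=> a; have [] := SP a.
(* Each neighbourhood of [y] meets [S b] for some [b] above [a], and [S b] lies in [C b], hence in
   [C a]; so [y] is in the closure of [C a]. *)
exists y => a _; apply: Ccl => U /Sy/(card_eq_unbounded a)[b [x [Sx Ux]] ab].
by exists x; split=> //; apply: Cdec ab _ _; have [_] := SP b; apply.
Qed.

Lemma decreasing_nu_nu_compact : infinite_cardinal nu ->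
  decreasing_compact nu G -> nu_nu_compact nu G.
Proof.
move=> nuinf dec C Ccl CG.
(* Intersecting over closed initial segments makes the family decreasing, and these segments are
   smaller than [nu]. *)
have [|||y Cy] := dec (fun a => \bigcap_(b in [set b | cle b a]) C b).
- by move=> a; apply: closed_bigI.
- by move=> a b ab x Cx c ca; apply: Cx; exact: cle_trans ca ab.
- by move=> a; exact/CG/card_lt_initial.
- by exists y => a _; apply: (Cy a) => //; exact: cle_refl.
Qed.

Lemma nu_nu_compact_decreasing : regular_cardinal nu ->
  nu_nu_compact nu G -> decreasing_compact nu G.
Proof.
move=> [nuinf nureg] cpt C Ccl Cdec CG; apply: cpt => // Z /andP[_ /negP Zlt].
(* By regularity a smaller set is bounded by some [a], so [C a] lies below the whole intersection
   over [Z]. *)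
have /existsNP[a aZ] : ~ cofinal Z by move=> /nureg.
have [A GA AC] := CG a; exists A => // x /AC Cx b Zb.
apply: (Cdec b a) => //; have [ab|//] := cle_total a b.
by case: aZ; exists b.
Qed.

Lemma decreasing_CAP_star : regular_cardinal nu ->
  decreasing_compact nu G -> CAP_star nu G.
Proof.
move=> [nuinf nureg] dec S SG.
(* For a point in the closures of all tails, the indices whose set meets a given neighbourhood are
   cofinal, hence [nu] many by regularity. *)
have [|||y Cy] := dec
    (fun a => closure (\bigcup_(b in [set b | cle a b]) S b)).
- by move=> a; exact: closed_closure.
- move=> a b ab; apply: closure_subset => x [c bc Sx].
  by exists c => //; exact: cle_trans ab bc.
- move=> a; exists (S a) => // x Sx; apply: subset_closure.
  by exists a => //; exact: cle_refl.
- exists y => U yU; apply: nureg => a.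
  have [x [[b ab Sx] Ux]] := Cy a I U yU.
  by exists b => //; exists x.
Qed.

End DecreasingFamilies.

(** * Indexing sequences and set systems by cardinal powers *)

Lemma card_of_surj (T : Type) :
  exists q : card_of T -> T, forall t, exists k, q k = t.
Proof.
have /card_bijP[f [g fg gf]] := projT2 (cid (card_of_ex T)).
exists (fun k => val (f (SigSub (mem_set (I : [set: card_of T] k))))) => t.
exists (val (g (SigSub (mem_set (I : [set: T] t))))).
set k := g _; have -> : SigSub (mem_set (I : [set: card_of T] (val k))) = k.
  exact: val_inj.
by rewrite /k gf.
Qed.

(** Supplies a power with one coordinate for each sequence of members of [G]. A surjection suffices,
    since coordinates may repeat. *)
Lemma cexp_card_set_surj T (G : set T) (nu : cardinal) :
  exists2 q : cexp (card_set G) nu -> nu -> T, forall k a, G (q k a) &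
    forall S, (forall a, G (S a)) -> exists k, q k = S.
Proof.
have [p psurj] := card_of_surj (nu -> card_set G).
have [r rsurj] := card_of_surj {x : T | G x}.
exists (fun k a => sval (r (p k a))); first by move=> k a; exact: svalP.
move=> S GS.
have /choice[s sP] : forall a, exists c, r c = exist G (S a) (GS a).
  by move=> a; exact: rsurj.
have [k kE] := psurj s; exists k; apply/funext => a.
by rewrite kE sP.
Qed.

Lemma cexp2_surj (nu : cardinal) : exists q : cexp ctwo (cexp ctwo nu) ->
  set_system nu, forall D, exists k, q k = D.
Proof.
have [p psurj] := card_of_surj (cexp ctwo nu -> ctwo).
have [r rsurj] := card_of_surj (nu -> ctwo).
have [b /choice[b' bK]] := card_of_surj bool.
exists (fun k => [set A | exists2 c, [set a | b (r c a)] = A & b (p k c)]) => D.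
(* A subset of [nu] may have several codes [c]; the value depends only on the subset coded, so all
   its codes agree. *)
have [k kE] := psurj (fun c => b' `[< D [set a | b (r c a)] >]).
exists k; apply/seteqP; split=> A.
  by move=> [c <-]; rewrite kE bK => /asboolP.
move=> DA; have [c cE] := rsurj (fun a => b' `[< A a >]).
have cA : [set a | b (r c a)] = A.
  by apply/seteqP; split=> a /=; rewrite cE bK => /asboolP.
by exists c => //; rewrite kE bK cA; exact/asboolP.
Qed.

(** * Equivalence of the conditions for a family of sets *)

Section FamilyConditions.
Variables (X : topologicalType) (nu : cardinal).
Implicit Types F G : set (set X).

(** Bundling [delta] sequences into one sequence of boxes makes a single ultrafilter serve all of
    them. *)
Lemma CAP_star_power_limit F (delta : cardinal) (S : delta -> nu -> set X) :
  infinite_cardinal nu -> CAP_star nu (family_power F delta) ->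
  (forall i a, F (S i a)) ->
  exists2 D, uniform_ultrafilter D &
    forall i, exists y, limit_point_along D (S i) y.
Proof.
move=> nuinf cap FS.
have [a|y Sy] := cap (fun a => box (S^~ a)); first by exists (S^~ a).
have [D uD Dy] := complete_accumulation_point_limit nuinf Sy.
exists D => // i; exists (y i); have [DU _] := uD.
exact: box_limit_proj Dy.
Qed.

(** [G] is kept apart from [F] so that, for open sets, the exponent can be computed from a base; for
    an arbitrary family [G] is [F] itself. *)
Lemma CAP_star_power_condA1 F G : infinite_cardinal nu -> G `<=` F ->
  (forall A, F A -> exists2 B, G B & B `<=` A) ->
  CAP_star nu (family_power F
    (cmin (cexp ctwo (cexp ctwo nu)) (cexp (card_set G) nu))) ->
  condA1 nu F.
Proof.
move=> nuinf GF FG; rewrite /cmin; case: ifP => _ cap; last first.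
  have [q qG qsurj] := cexp_card_set_surj G nu.
  have [D uD Dlim] := CAP_star_power_limit nuinf cap (fun i a => GF _ (qG i a)).
  exists D => //; have [DU _] := uD.
  apply: (D_compact_refine _ FG) => S /qsurj[k <-]; exact: Dlim.
(* Remaining case: the exponent is the double power set of [nu]. If every uniform ultrafilter had a
   bad sequence, taking these as coordinates would give an ultrafilter that has limit points for its
   own bad sequence. *)
apply: contrapT => nA1.
have bad D : uniform_ultrafilter D -> exists S : nu -> set X,
    (forall a, F (S a)) /\ forall y, ~ limit_point_along D S y.
  move=> uD; apply: contrapT => nS; apply: nA1; exists D => // S FS.
  by apply: contrapT => /forallNP ny; apply: nS; exists S.
(* Coordinates run over all set systems; the bad sequence [S0] of some [D0] is the default for those
   that are not uniform ultrafilters. *)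
have [|D0 uD0 _] := uniform_ultrafilter_ext nuinf (globally_filter [set: nu]).
  by move=> A TA; have -> : A = setT by apply/seteqP; split.
have [S0 [FS0 _]] := bad D0 uD0.
have /choice[S SP] : forall D, exists S : nu -> set X, (forall a, F (S a)) /\
    (uniform_ultrafilter D -> forall y, ~ limit_point_along D S y).
  move=> D; have [/bad[S [FS nS]]|nD] := pselect (uniform_ultrafilter D).
    by exists S.
  by exists S0.
have [q qsurj] := cexp2_surj nu.
have [|D uD Dlim] := CAP_star_power_limit (S := S \o q) nuinf cap.
  by move=> i a; have [+ _] := SP (q i); apply.
have [k kD] := qsurj D; have [y] := Dlim k; rewrite /= kD.
by have [_ /(_ uD y)] := SP D.
Qed.

Lemma D_compact_power F (D : set_system nu) (delta : cardinal) :
  ProperFilter D -> D_compact F D -> D_compact (family_power F delta) D.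
Proof.
move=> PD cpt P FP.
(* A constant sequence with an empty member would have no limit point, as [D] is proper. *)
have F0 A : F A -> A !=set0.
  move=> FA; have [y /(_ _ filterT)/filter_ex[_ [x [Ax _]]]] := cpt (fun=> A) (fun=> FA).
  by exists x.
have /choice[S SP] : forall a, exists S : delta -> set X,
    (forall i, F (S i)) /\ P a = box S.
  by move=> a; have [S] := FP a; exists S.
have FS i a : F (S a i) by have [+ _] := SP a; apply.
have /choice[y yP] : forall i, exists y, limit_point_along D (S^~ i) y.
  by move=> i; apply: cpt => a; exact: FS.
exists y; have -> : P = fun a => box (S a).
  by apply/funext => a; have [] := SP a.
by apply: (@family_power_limit _ _ _ _ (fun i a => S a i)) => // i a; exact: F0.
Qed.

Lemma condA1_condA2 F : condA1 nu F -> condA2 nu F.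
Proof.
by move=> [D uD cpt]; exists D => // delta; have [DU _] := uD; exact: D_compact_power.
Qed.

Lemma condA2_condA3 F : condA2 nu F -> condA3 nu F.
Proof.
by move=> [D uD cpt] delta; exact: D_compact_CAP_star uD (cpt delta).
Qed.

Lemma condA3_condA4 F : condA3 nu F -> condA4 nu F.
Proof. exact. Qed.

Lemma condA4_condA1 F : infinite_cardinal nu -> condA4 nu F -> condA1 nu F.
Proof.
move=> nuinf; apply: CAP_star_power_condA1 => // A FA; exists A => //.
Qed.

End FamilyConditions.

(** * Equivalence of the conditions for open sets *)

Section OpenConditions.
Variables (X : topologicalType) (nu : cardinal).

(** A nonempty box-open set contains a product of nonempty open sets, and such products are
    box-open; so each reading refines the other. *)
Lemma open_power_refine (r s : open_reading) (delta : cardinal) A :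
  open_power r X delta A -> exists2 B, open_power s X delta B & B `<=` A.
Proof.
have boxP (S : delta -> set X) : (forall i, open (S i) /\ S i !=set0) ->
    open_power s X delta (box S).
  case: s => oS; first by exists S.
  split; first by move=> x Sx; exists S; split=> // i; have [] := oS i.
  have /choice[x xP] : forall i, exists x, S i x by move=> i; have [_] := oS i.
  by exists x.
case: r => [[S oS ->]|[oA [x /oA[S [oS Sx SA]]]]]; exists (box S) => //.
  exact: boxP.
by apply: boxP => i; split=> //; exists (x i).
Qed.

Lemma condB1_condB2 r : condB1 X nu -> condB2 X nu r.
Proof.
(* [condB1] unfolds to [condA1] for the family of nonempty open sets. *)
move=> /condA1_condA2[D uD cpt]; exists D => // delta; have [DU _] := uD.
by apply: D_compact_refine (cpt delta) => A; exact: (open_power_refine OpenProducts).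
Qed.

Lemma condB2_condB3 r : condB2 X nu r -> condB3 X nu r.
Proof.
by move=> [D uD cpt] delta; exact: D_compact_CAP_star uD (cpt delta).
Qed.

Lemma condB3_condB4 r : condB3 X nu r -> condB4 X nu r.
Proof. exact. Qed.

Lemma condB4_condB1 r : infinite_cardinal nu -> condB4 X nu r -> condB1 X nu.
Proof.
move=> nuinf; have [[Bbasis B0] _] := projT2 (cid (weight_ex X)).
have [Bopen Bnbhs] := Bbasis.
(* First pass to products of open sets, then take for [G] the base of least cardinality that defines
   the weight. *)
move=> /(CAP_star_refine (@open_power_refine OpenProducts r _)).
apply: CAP_star_power_condA1 => // [U BU|A [oA [x Ax]]].
  by split; [exact: Bopen|exact: B0].
have [U [BU Ux] UA] : filter_from
    [set U | projT1 (cid (weight_ex X)) U /\ U x] id A.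
  by apply: Bnbhs; exact: open_nbhs_nbhs.
by exists U.
Qed.

Lemma condB3_condB6 r : condB3 X nu r -> condB6 X nu r.
Proof. by move=> cap delta; exact/CAP_star_decreasing. Qed.

Lemma condB6_condB5 r : infinite_cardinal nu -> condB6 X nu r -> condB5 X nu r.
Proof. by move=> nuinf dec delta; exact/decreasing_nu_nu_compact. Qed.

Lemma condB5_condB6 r : regular_cardinal nu -> condB5 X nu r -> condB6 X nu r.
Proof. by move=> nureg cpt delta; exact/nu_nu_compact_decreasing. Qed.

Lemma condB6_condB3 r : regular_cardinal nu -> condB6 X nu r -> condB3 X nu r.
Proof. by move=> nureg dec delta; exact/decreasing_CAP_star. Qed.

End OpenConditions.

(** * Transfer along a decomposition *)

Lemma condA1_decomposable (X : topologicalType) (F : set (set X))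
    (lambda : cardinal) (K : cardinal -> Prop) :
  (forall D : set_system lambda, uniform_ultrafilter D ->
    exists2 mu, K mu & decomposable D mu) ->
  condA1 lambda F -> exists2 mu, K mu & condA1 mu F.
Proof.
move=> dec [D uD cpt]; have [mu Kmu [f ufD]] := dec D uD.
by exists mu => //; exists (fmap f D) => //; exact: D_compact_fmap.
Qed.

Theorem corollary6p2 (lambda : cardinal) (K : cardinal -> Prop)
    (lambda_inf : infinite_cardinal lambda)
    (K_inf : forall mu, K mu -> infinite_cardinal mu)
    (lambda_dec : forall D : set_system lambda, uniform_ultrafilter D ->
       exists2 mu, K mu & decomposable D mu) :
  (forall (X : topologicalType) (F : set (set X)),
     condA1 lambda F \/ condA2 lambda F \/
     condA3 lambda F \/ condA4 lambda F ->
     exists2 mu, K mu &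
       [/\ condA1 mu F, condA2 mu F, condA3 mu F & condA4 mu F])
  /\
  (forall (X : topologicalType) (r : open_reading),
     condB1 X lambda \/ condB2 X lambda r \/
     condB3 X lambda r \/ condB4 X lambda r \/
     (regular_cardinal lambda /\
        (condB5 X lambda r \/ condB6 X lambda r)) ->
     exists2 mu, K mu & forall s : open_reading,
       [/\ condB1 X mu, condB2 X mu s, condB3 X mu s, condB4 X mu s &
         regular_cardinal mu -> condB5 X mu s /\ condB6 X mu s]).
Proof.
split=> [X F cA|X r cB].
  have A1 : condA1 lambda F.
    case: cA => [//|[A2|[A3|A4]]]; apply: condA4_condA1 => //.
      exact/condA3_condA4/condA2_condA3.
    exact/condA3_condA4.
  have [mu Kmu A1mu] := condA1_decomposable lambda_dec A1.
  have A2mu := condA1_condA2 A1mu; have A3mu := condA2_condA3 A2mu.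
  by exists mu => //; split=> //; exact: condA3_condA4.
have B1 : condB1 X lambda.
  case: cB => [//|[B2|[B3|[B4|[reg B56]]]]]; apply: (@condB4_condB1 _ _ r) => //.
  - exact/condB3_condB4/condB2_condB3.
  - exact/condB3_condB4.
  - apply: condB3_condB4; apply: condB6_condB3 => //.
    by case: B56 => // B5; exact: condB5_condB6.
have [mu Kmu B1mu] := condA1_decomposable lambda_dec B1.
(* [condB1] mentions no reading, so the conclusion holds for every [s], whichever [r] was
   assumed. *)
exists mu => // s.
have B2mu := condB1_condB2 s B1mu; have B3mu := condB2_condB3 B2mu.
have B6mu := condB3_condB6 B3mu.
split=> //; first exact: condB3_condB4.
by move=> _; split=> //; apply: condB6_condB5 => //; exact: K_inf.
Qed.
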